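(* Let $\mathcal{P}=\langle\Sigma\mid\mathcal{R}\rangle$ be a semigroup presentation, $w\in\Sigma^+$ a base word, and let $X(\mathcal{P},w)$ denote the universal cover of the Squier complex $S(\mathcal{P},w)$. If $d=\dim S(\mathcal{P},w)$ is finite, then $X(\mathcal{P},w)$ isometrically embeds into a product of $d$ trees with respect to the combinatorial metrics.
   Context: A semigroup presentation $\mathcal{P}=\langle\Sigma\mid\mathcal{R}\rangle$ consists of an alphabet $\Sigma$ and a set $\mathcal{R}$ of relations $u=v$ with $u,v\in\Sigma^+$. Here $\Sigma^+$ is the free semigroup of non-empty words and $\Sigma^*=\Sigma^+\cup\{1\}$ also contains the empty word $1$. Convention: if $u=v\in\mathcal{R}$ then $v=u\notin\mathcal{R}$ (in particular $u=u\notin\mathcal{R}$). The Squier complex $S(\mathcal{P})$ is the cube complex whose vertices are the words over $\Sigma$; whose oriented edges are $(a,u\to v,b)$ with $a,b\in\Sigma^*$ and $u=v$ or $v=u$ in $\mathcal{R}$, going from $aub$ to $avb$ (and $(a,v\to u,b)$ is the same edge with opposite orientation); and whose $n$-cubes are similarly $(a_1,u_1\to v_1,\dots,a_n,u_n\to v_n,a_{n+1})$, spanned by the vertices $a_1w_1\cdots a_nw_na_{n+1}$ with $w_i\in\{u_i,v_i\}$. $S(\mathcal{P},w)$ is the connected component containing $w$; it is nonpositively curved, so its universal cover, with the lifted cubical structure, is a CAT(0) cube complex. The combinatorial metric on a connected cube complex is the graph metric of its 1-skeleton, defined on the set of vertices. A product of $d$ trees is viewed as a cube complex, so its combinatorial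 metric is the sum ($\ell^1$) of the graph metrics of the factors. *)

(* Defs.v *)
From Stdlib Require List.
From Stdlib Require Import Relation_Operators.
From mathcomp Require Import all_boot.
From mathcomp Require Import boolp classical_sets.

Set Implicit Arguments.
Unset Strict Implicit.
Unset Printing Implicit Defensive.

Local Open Scope nat_scope.

Record graph := Graph {
  vert :> Type;
  adj : vert -> vert -> Prop
}.

Fixpoint walk (G : graph) (x : G) (s : seq G) (y : G) : Prop :=
  if s is z :: s' then adj x z /\ walk z s' y else x = y.

Definition graph_connected (G : graph) : Prop :=
  inhabited G /\ forall x y : G, exists s, walk x s y.

(* The least length of a walk from x to y (and 0 if there is no such walk). *)
Definition graph_dist (G : graph) (x y : G) : nat :=
  xget 0 [set n | (exists2 s, walk x s y & size s = n) /\
                  forall s, walk x s y -> n <= size s].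

(* A cycle is x :: s with at least 3 vertices, all distinct, consecutive ones
   being adjacent as well as the last and the first ones. *)
Definition acyclic (G : graph) : Prop :=
  forall (x : G) (s : seq G),
    2 <= size s -> List.NoDup (x :: s) -> walk x s (last x s) ->
    ~ adj (last x s) x.

Record is_tree (G : graph) : Prop := IsTree {
  tree_sym : forall x y : G, adj x y -> adj y x;
  tree_irrefl : forall x : G, ~ adj x x;
  tree_connected : graph_connected G;
  tree_acyclic : acyclic G
}.

(* Cube complexes are presented as precubical sets: [cell n] is the set of
   n-cubes [0,1]^n, and [face e i c] is the codimension-one face of c where the
   i-th coordinate equals e (false for 0, true for 1).  Distinct cubes may have
   the same vertices. *)
Record cube_complex := CubeComplex {
  cell :> nat -> Type;
  face : forall n, bool -> 'I_n.+1 -> cell n.+1 -> cell n;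
  face_face : forall n e e' (i j : 'I_n.+1) (c : cell n.+2), i <= j ->
    face e i (face e' (lift ord0 j) c) =
    face e' j (face e (widen_ord (leqnSn n.+1) i) c)
}.

(* The vertex of the cube c with coordinates e. *)
Fixpoint corner (X : cube_complex) n : X n -> ('I_n -> bool) -> X 0 :=
  match n with
  | 0 => fun c _ => c
  | m.+1 => fun c e => corner (face (e ord0) ord0 c) (fun i => e (lift ord0 i))
  end.

Definition has_dim (X : cube_complex) (d : nat) : Prop :=
  inhabited (X d) /\ forall n, inhabited (X n) -> n <= d.

(* (c, b) is the edge c travelled from 0 to 1 if b = false and from 1 to 0 if
   b = true. *)
Definition oedge (X : cube_complex) : Type := (X 1 * bool)%type.
Definition osource (X : cube_complex) (o : oedge X) : X 0 := face o.2 ord0 o.1.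
Definition otarget (X : cube_complex) (o : oedge X) : X 0 :=
  face (~~ o.2) ord0 o.1.
Definition orev (X : cube_complex) (o : oedge X) : oedge X := (o.1, ~~ o.2).

Definition skeleton (X : cube_complex) : graph :=
  @Graph (X 0) (fun x y => exists2 o : oedge X, osource o = x & otarget o = y).

Definition comb_dist (X : cube_complex) (x y : X 0) : nat :=
  @graph_dist (skeleton X) x y.

(* Edges of a cube complex need not be determined by their endpoints, so
   homotopies are defined on sequences of oriented edges. *)
Fixpoint edge_path (X : cube_complex) (x : X 0) (s : seq (oedge X)) (y : X 0) :
    Prop :=
  if s is o :: s' then osource o = x /\ edge_path (otarget o) s' y else x = y.

(* The two ways of going from (0,0) to (1,1) along the boundary of a square;
   together with the removal of backtracks, they generate all the homotopies
   across that square. *)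
Inductive elementary_homotopy (X : cube_complex) :
    seq (oedge X) -> seq (oedge X) -> Prop :=
  | Backtrack s t o :
      elementary_homotopy (s ++ [:: o; orev o] ++ t) (s ++ t)
  | Square s t (c : X 2) :
      elementary_homotopy
        (s ++ [:: (face false ord_max c, false); (face true ord0 c, false)] ++ t)
        (s ++ [:: (face false ord0 c, false); (face true ord_max c, false)] ++ t).

Definition homotopic (X : cube_complex) (x y : X 0) :
    seq (oedge X) -> seq (oedge X) -> Prop :=
  clos_refl_sym_trans _
    (fun s t => [/\ edge_path x s y, edge_path x t y & elementary_homotopy s t]).

Definition simply_connected (X : cube_complex) : Prop :=
  graph_connected (skeleton X) /\
  forall (x : X 0) s, edge_path x s x -> homotopic x x s [::].

(* A covering map is a cubical map that is bijective on the stars of vertices: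
   every cube lifts uniquely once the lift of one of its corners is given. *)
Record is_covering (X Y : cube_complex) (p : forall n, X n -> Y n) : Prop :=
  IsCovering {
    covering_face : forall n e (i : 'I_n.+1) (c : X n.+1),
      p n (face e i c) = face e i (p n.+1 c);
    covering_lift : forall n (c : Y n) (e : 'I_n -> bool) (x : X 0),
      corner c e = p 0 x -> exists! c' : X n, corner c' e = x /\ p n c' = c
  }.

Definition is_universal_cover (X Y : cube_complex)
    (p : forall n, X n -> Y n) : Prop :=
  is_covering p /\ simply_connected X.

Section Component.
Variables (X : cube_complex) (x : X 0).

Definition in_component n (c : X n) : Prop :=
  forall e : 'I_n -> bool, exists s, @walk (skeleton X) x s (corner c e).

Lemma cornerS n (c : X n.+1) b (f : 'I_n -> bool) :
  corner c (fun k => if unlift ord0 k is Some k' then f k' else b) =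
  corner (face b ord0 c) f.
Proof.
rewrite /= unlift_none /=.
by apply: (congr1 (corner _)); apply: funext => k; rewrite liftK.
Qed.

Lemma corner_face n e (i : 'I_n.+1) (c : X n.+1) (f : 'I_n -> bool) :
  exists g, corner (face e i c) f = corner c g.
Proof.
elim: n => [|n IH] in e i c f *.
  by exists (fun=> e); rewrite (ord1 i).
case: (unliftP ord0 i) => [j ->|->]; last first.
  by exists (fun k => if unlift ord0 k is Some k' then f k' else e); rewrite cornerS.
have [g Hg] := IH e j (face (f ord0) ord0 c) (fun k => f (lift ord0 k)).
exists (fun k => if unlift ord0 k is Some k' then g k' else f ord0).
rewrite cornerS -Hg [LHS]/= face_face //.
by congr (corner (face _ _ (face _ _ _)) _); apply: val_inj.
Qed.

Definition component_face n (e : bool) (i : 'I_n.+1)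
    (c : {c : X n.+1 | in_component c}) :
    {c : X n | in_component c}.
Proof.
exists (face e i (sval c)) => f.
by have [g ->] := corner_face e i (sval c) f; exact: (svalP c).
Defined.

Lemma component_face_face n e e' (i j : 'I_n.+1)
    (c : {c : X n.+2 | in_component c}) : i <= j ->
  component_face e i (component_face e' (lift ord0 j) c) =
  component_face e' j (component_face e (widen_ord (leqnSn n.+1) i) c).
Proof. by move=> ij; apply: eq_exist; exact: face_face. Qed.

Definition component : cube_complex := CubeComplex component_face_face.

End Component.

Record presentation (Sigma : Type) := Presentation {
  relations : seq Sigma -> seq Sigma -> Prop;
  relations_neq1 : forall u v, relations u v -> u <> [::] /\ v <> [::];
  relations_asym : forall u v, relations u v -> ~ relations v u
}.

Section Squier.
Variables (Sigma : Type) (P : presentation Sigma).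

(* The n-cube (a_1, u_1 -> v_1, ..., a_n, u_n -> v_n, a_{n+1}) is encoded as
   (a_1, (u_1, v_1), (a_2, (u_2, v_2), ... a_{n+1})).  Reversing some of the
   arrows yields the same cube; by [relations_asym], exactly one choice of
   orientations is such that u_i = v_i is in R for all i, and we use it.
   (Proofs of u_i = v_i in R are unique by proof irrelevance, which boolp
   provides.) *)
Fixpoint squier_cube (n : nat) : Type :=
  if n is m.+1 then
    (seq Sigma * {r : seq Sigma * seq Sigma | relations P r.1 r.2}
     * squier_cube m)%type
  else seq Sigma.

Definition prepend n (a : seq Sigma) : squier_cube n -> squier_cube n :=
  match n with
  | 0 => fun b => a ++ b
  | m.+1 => fun c => (a ++ c.1.1, c.1.2, c.2)
  end.

(* Replaces the first arrow u_1 -> v_1 by the word u_1 if e = false and by the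
   word v_1 if e = true. *)
Definition squier_face0 n (e : bool) (c : squier_cube n.+1) : squier_cube n :=
  let: (a, r, c') := c in
  prepend (a ++ (if e then (sval r).2 else (sval r).1)) c'.

Fixpoint squier_face_nat n (e : bool) (i : nat) :
    squier_cube n.+1 -> squier_cube n :=
  match n, i return squier_cube n.+1 -> squier_cube n with
  | m.+1, k.+1 => fun c : squier_cube m.+2 => (c.1, squier_face_nat e k c.2)
  | m, _ => @squier_face0 m e
  end.

Definition squier_face n (e : bool) (i : 'I_n.+1) :
    squier_cube n.+1 -> squier_cube n := squier_face_nat e i.

Lemma prepend_cat n a b (c : squier_cube n) :
  prepend a (prepend b c) = prepend (a ++ b) c.
Proof. by case: n c => [|n] c /=; rewrite catA. Qed.

Lemma squier_face_prepend n e i a (c : squier_cube n.+1) :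
  squier_face_nat e i (prepend a c) = prepend a (squier_face_nat e i c).
Proof.
have face0_prepend m (c' : squier_cube m.+1) :
    squier_face0 e (prepend a c') = prepend a (squier_face0 e c').
  by case: c' => [[b r] c'] /=; rewrite prepend_cat catA.
by case: n i c => [|n] [|i] c; try exact: face0_prepend.
Qed.

Lemma squier_face_face n (e e' : bool) (i j : 'I_n.+1) (c : squier_cube n.+2) :
  i <= j ->
  squier_face e i (squier_face e' (lift ord0 j) c) =
  squier_face e' j (squier_face e (widen_ord (leqnSn n.+1) i) c).
Proof.
rewrite /squier_face [nat_of_ord (widen_ord _ _)]/= [nat_of_ord (lift _ _)]/=.
rewrite /bump leq0n add1n.
case: i j => [i _] [j jn] /=.
have face0_face m k (c' : squier_cube m.+2) :
    squier_face0 e (squier_face_nat e' k.+1 c') =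
    squier_face_nat e' k (squier_face0 e c').
  by case: c' => [[a r] c'] /=; rewrite squier_face_prepend.
elim: n i j jn c => [|n IH] [|i] [|j] // jn c ij;
  try exact: face0_face.
- exact: (face0_face n.+1 0 c).
- exact: (face0_face n.+1 j.+1 c).
- exact: (congr1 (pair c.1) (IH i j jn c.2 ij)).
Qed.

Definition squier_complex : cube_complex := CubeComplex squier_face_face.

Definition squier_component (w : seq Sigma) : cube_complex :=
  @component squier_complex w.

End Squier.

(* Main.v *)
(* Colour an edge (a, u -> v, b) of the Squier complex by the dimension of
   S(P, b).  Opposite edges of a square have the same colour, as a move inside
   b does not change the component of b; in a square
   (a1, u1 -> v1, a2, u2 -> v2, a3) the left edge has the larger colour, since
   a2 u2 a3 has an extra independent move compared with a3.  Hence there are at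
   most d colours, each colour is constant along hyperplanes, and transverse
   hyperplanes have different colours.  The i-th tree is obtained from X by
   contracting all the edges whose colour is not i.  It is a tree because its
   edges are hyperplanes and the parity of the number of crossings with a given
   hyperplane is invariant under homotopy.  The distances add up because a
   geodesic crosses every hyperplane at most once; this follows from a
   Church-Rosser argument for paths up to homotopy, in which the steps are
   flipping two consecutive edges across a square and cancelling a backtrack. *)

From Stdlib Require List.
From Stdlib Require Import Relation_Operators.
From mathcomp Require Import all_boot zify.
From mathcomp Require Import boolp classical_sets.
Require Import Defs.

Set Implicit Arguments.
Unset Strict Implicit.
Unset Printing Implicit Defensive.

Local Open Scope nat_scope.

(** * Reduction of paths across squares *)

Section SquareRewriting.
Variables (E : Type) (rev : E -> E) (sq : E -> E -> E -> E -> Prop).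
Hypothesis revK : involutive rev.
Hypothesis sq_sym : forall a b c d, sq a b c d -> sq c d a b.
Hypothesis sq_rot : forall a b c d, sq a b c d -> sq (rev a) c b (rev d).
Hypothesis sq_det : forall a b c d c' d',
  sq a b c d -> sq a b c' d' -> c = c' /\ d = d'.
Hypothesis sq_irr : forall a c d, ~ sq a (rev a) c d.
(** This is the link condition of nonpositive curvature, restricted to squares: three squares that
    pairwise share an edge at a vertex are completed by the three opposite squares of a cube. *)
Hypothesis sq_cube : forall o a a' o1 b b' o2 d e,
  sq o a a' o1 -> sq o1 b b' o2 -> sq a b d e ->
  exists d' o1' e', [/\ sq o d d' o1', sq o1' e e' o2 & sq a' b' d' e'].

Inductive swap : seq E -> seq E -> Prop :=
  | SwapHead a b c d t : sq a b c d -> swap [:: a, b & t] [:: c, d & t]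
  | SwapCons x p q : swap p q -> swap (x :: p) (x :: q).

Inductive cancel : seq E -> seq E -> Prop :=
  | CancelHead o t : cancel [:: o, rev o & t] t
  | CancelCons x p q : cancel p q -> cancel (x :: p) (x :: q).

(** A strip of squares in the carrier of a hyperplane: [o] and [o'] are its end rungs, [m] its rail
    from the target of [o] and [m'] its rail from the source. *)
Inductive ladder : E -> seq E -> E -> seq E -> Prop :=
  | LadderNil o : ladder o [::] o [::]
  | LadderCons o a a' o1 m o' m' : sq o a a' o1 -> ladder o1 m o' m' ->
      ladder o (a :: m) o' (a' :: m').

(* Cancellation of two edges which become consecutive and inverse to each
   other after pushing the first one along a ladder. *)
Inductive far_cancel : seq E -> seq E -> Prop :=
  | FarCancelHead o m o' m' t : ladder o m o' m' ->
      far_cancel (o :: m ++ rev o' :: t) (m' ++ t)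
  | FarCancelCons x p q : far_cancel p q -> far_cancel (x :: p) (x :: q).

Definition reduction_step (p q : seq E) : Prop := swap p q \/ cancel p q.
Definition reduces : seq E -> seq E -> Prop :=
  clos_refl_trans_1n _ reduction_step.
Definition equivalent : seq E -> seq E -> Prop :=
  clos_refl_sym_trans _ reduction_step.

(** Far cancellations are excluded, not only backtracks, because swaps may bring two distant inverse
    edges together. *)
Definition irreducible (p : seq E) : Prop := forall q, ~ far_cancel p q.

Lemma sq_back a b c d : sq a b c d -> sq d (rev b) (rev c) a.
Proof.
by move=> /sq_rot/sq_sym/sq_rot/sq_sym/sq_rot; rewrite !revK.
Qed.

Lemma sq_turn a b c d : sq a b c d -> sq b (rev d) (rev a) c.
Proof. by move=> /sq_rot/sq_sym. Qed.

Lemma ladder_nilE o o' k : ladder o [::] o' k -> o' = o /\ k = [::].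
Proof. by move=> L; inversion L. Qed.

Lemma ladder_consE o a m o' k : ladder o (a :: m) o' k ->
  exists a' o1 m', [/\ k = a' :: m', sq o a a' o1 & ladder o1 m o' m'].
Proof. by move=> L; inversion L; subst; exists a', o1, m'. Qed.

Lemma swap_consE x p r : swap (x :: p) r ->
  (exists b t c d, [/\ p = b :: t, sq x b c d & r = [:: c, d & t]]) \/
  exists2 q, swap p q & r = x :: q.
Proof.
by move=> S; inversion S; subst; [left; exists b, t, c, d|right; exists q].
Qed.

Lemma cancel_consE x p r :
  cancel (x :: p) r -> p = rev x :: r \/ exists2 q, cancel p q & r = x :: q.
Proof. by move=> S; inversion S; subst; [left|right; exists q]. Qed.

Lemma far_cancel_consE x p r : far_cancel (x :: p) r ->
  (exists m o' m' t,
     [/\ p = m ++ rev o' :: t, ladder x m o' m' & r = m' ++ t]) \/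
  exists2 q, far_cancel p q & r = x :: q.
Proof.
by move=> S; inversion S; subst; [left; exists m, o', m', t|right; exists q].
Qed.

Lemma ladder_cat o m o1 m' n o2 n' :
  ladder o m o1 m' -> ladder o1 n o2 n' -> ladder o (m ++ n) o2 (m' ++ n').
Proof. by elim=> //= *; apply: LadderCons; eauto. Qed.

Lemma ladder_split o m n o' k : ladder o (m ++ n) o' k ->
  exists o1 m' n', [/\ k = m' ++ n', ladder o m o1 m' & ladder o1 n o' n'].
Proof.
elim: m o k => [|a m IH] o k /= H.
  by exists o, [::], k; split=> //; exact: LadderNil.
have [a' [o1 [k1 [-> s /IH[o2 [m1 [n1 [-> ? ?]]]]]]]] := ladder_consE H.
by exists o2, (a' :: m1), n1; split=> //; exact: LadderCons s _.
Qed.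

Lemma ladder_rev o m o' m' : ladder o m o' m' -> ladder (rev o) m' (rev o') m.
Proof.
elim=> [?|{}o a a' o1 {}m {}o' {}m' /sq_rot s _ IH]; first exact: LadderNil.
exact: LadderCons s IH.
Qed.

Lemma ladder_back o m o' m' :
  ladder o m o' m' -> ladder o' (map rev (seq.rev m)) o (map rev (seq.rev m')).
Proof.
elim=> [?|{}o a a' o1 {}m {}o' {}m' /sq_back s _ IH]; first exact: LadderNil.
rewrite !rev_cons !map_rcons -!cats1; apply: ladder_cat IH _.
by apply: LadderCons s _; exact: LadderNil.
Qed.

(** The swapped square and the two squares of the ladder next to it meet at a vertex; [sq_cube]
    gives the opposite square, on the other rail. *)
Lemma ladder_swap o m o' m' n : ladder o m o' m' -> swap m n ->
  exists2 n', ladder o n o' n' & swap m' n'.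
Proof.
move=> L S; elim: S o m' L => [a b c d t s|x p q _ IH] o k
  /ladder_consE[a' [o1 [m' [-> s1 L]]]].
  have [b' [o2 [n' [-> s2 L']]]] := ladder_consE L.
  have [d' [o1' [e' [s3 s4 ?]]]] := sq_cube s1 s2 s.
  exists [:: d', e' & n']; last exact: SwapHead.
  exact: LadderCons s3 (LadderCons s4 L').
have [n' ? ?] := IH _ _ L.
by exists (a' :: n'); [exact: LadderCons s1 _|exact: SwapCons].
Qed.

(** By determinism, the square over the return edge is the one just traversed, so the rung comes
    back to itself and the other rail backtracks too. *)
Lemma ladder_cancel o m o' m' n : ladder o m o' m' -> cancel m n ->
  exists2 n', ladder o n o' n' & cancel m' n'.
Proof.
move=> L S; elim: S o m' L => [b t|x p q _ IH] o k
  /ladder_consE[a' [o1 [m' [-> s1 L]]]].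
  have [b' [o2 [n' [-> s2 L']]]] := ladder_consE L.
  have [? ?] := sq_det (sq_back s1) s2; subst.
  by exists n' => //; exact: CancelHead.
have [n' ? ?] := IH _ _ L.
by exists (a' :: n'); [exact: LadderCons s1 _|exact: CancelCons].
Qed.

Lemma ladder_reduces o m o' m' n :
  ladder o m o' m' -> reduces m n -> exists n', ladder o n o' n'.
Proof.
move=> L R; elim: R m' L => [p m' L|p q r [S|S] _ IH m' L]; first by exists m'.
  by have [n' /IH] := ladder_swap L S.
by have [n' /IH] := ladder_cancel L S.
Qed.

Lemma reduces_refl p : reduces p p.
Proof. exact: Relation_Operators.rt1n_refl. Qed.

Lemma reduces_step p q r : reduction_step p q -> reduces q r -> reduces p r.
Proof. exact: Relation_Operators.rt1n_trans. Qed.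

Lemma reduces_trans p q r : reduces p q -> reduces q r -> reduces p r.
Proof. by elim=> // ? ? ? ? ? IH /IH; apply: reduces_step. Qed.

Lemma reduces1 p q : reduction_step p q -> reduces p q.
Proof. by move=> H; exact: reduces_step H (reduces_refl _). Qed.

Lemma reduces_cons x p q : reduces p q -> reduces (x :: p) (x :: q).
Proof.
elim=> [?|p1 q1 r1 S _ IH]; first exact: reduces_refl.
apply: reduces_step IH.
by case: S => S; [left; exact: SwapCons|right; exact: CancelCons].
Qed.

Lemma ladder_swaps o m o' m' t : ladder o m o' m' ->
  reduces (o :: m ++ t) (m' ++ o' :: t).
Proof.
elim=> [?|{}o a a' o1 {}m {}o' {}m' s _ IH] /=.
  exact: reduces_refl.
apply: reduces_step (reduces_cons a' IH).
by left; exact: SwapHead.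
Qed.

Lemma ladder_swaps_sym o m o' m' t : ladder o m o' m' ->
  reduces (m' ++ o' :: t) (o :: m ++ t).
Proof.
elim=> [?|{}o a a' o1 {}m {}o' {}m' s _ IH] /=.
  exact: reduces_refl.
apply: reduces_trans (reduces_cons a' IH) _; apply: reduces1.
by left; apply: SwapHead; exact: sq_sym.
Qed.

Lemma cancel_far p q : cancel p q -> far_cancel p q.
Proof.
elim=> [o t|x {}p {}q _ IH]; last exact: FarCancelCons.
exact: (@FarCancelHead o [::] o [::] t (LadderNil o)).
Qed.

Lemma swap_inv p q : swap p q -> swap q p.
Proof.
by elim=> [*|*]; [apply: SwapHead; exact: sq_sym|exact: SwapCons].
Qed.

Lemma swap_catl s p q : swap p q -> swap (s ++ p) (s ++ q).
Proof. by move=> H; elim: s => //= *; exact: SwapCons. Qed.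

Lemma swap_catr s p q : swap p q -> swap (p ++ s) (q ++ s).
Proof. by elim=> [*|*]; [exact: SwapHead|exact: SwapCons]. Qed.

Lemma cancel_catl s p q : cancel p q -> cancel (s ++ p) (s ++ q).
Proof. by move=> H; elim: s => //= *; exact: CancelCons. Qed.

Lemma cancel_catr s p q : cancel p q -> cancel (p ++ s) (q ++ s).
Proof. by elim=> [*|*]; [exact: CancelHead|exact: CancelCons]. Qed.

Lemma swap_around m z t r : swap (m ++ z :: t) r ->
  [\/ exists2 m1, swap m m1 & r = m1 ++ z :: t,
      exists2 t1, swap t t1 & r = m ++ z :: t1,
      exists m0 a c d, [/\ m = rcons m0 a, sq a z c d & r = m0 ++ [:: c, d & t]]
    | exists b t0 c d, [/\ t = b :: t0, sq z b c d & r = m ++ [:: c, d & t0]]].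
Proof.
elim: m r => [|a m IH] r /swap_consE[[b [t0 [c [d [e s ->]]]]]|[q S ->]].
- by apply: Or44; exists b, t0, c, d.
- by apply: Or42; exists q.
- case: m e {IH} => [|b' m] /= [? ?]; subst.
    by apply: Or43; exists [::], a, c, d.
  by apply: Or41; exists [:: c, d & m] => //; exact: SwapHead.
- case: (IH _ S) => [[m1 ? ->]|[t1 ? ->]|[m0 [a' [c [d [-> ? ->]]]]]
    |[b [t0 [c [d [-> ? ->]]]]]].
  + by apply: Or41; exists (a :: m1) => //; exact: SwapCons.
  + by apply: Or42; exists t1.
  + by apply: Or43; exists (a :: m0), a', c, d.
  + by apply: Or44; exists b, t0, c, d.
Qed.

Lemma cancel_around m z t r : cancel (m ++ z :: t) r ->
  [\/ exists2 m1, cancel m m1 & r = m1 ++ z :: t,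
      exists2 t1, cancel t t1 & r = m ++ z :: t1,
      exists m0 a, [/\ m = rcons m0 a, z = rev a & r = m0 ++ t]
    | exists t0, t = rev z :: t0 /\ r = m ++ t0].
Proof.
elim: m r => [|a m IH] r /cancel_consE[e|[q S ->]].
- by apply: Or44; exists r.
- by apply: Or42; exists q.
- case: m e {IH} => [|b' m] /= [? ?]; subst.
    by apply: Or43; exists [::], a.
  by apply: Or41; exists m => //; exact: CancelHead.
- case: (IH _ S) => [[m1 ? ->]|[t1 ? ->]|[m0 [a' [-> ? ->]]]|[t0 [-> ->]]].
  + by apply: Or41; exists (a :: m1) => //; exact: CancelCons.
  + by apply: Or42; exists t1.
  + by apply: Or43; exists (a :: m0), a'.
  + by apply: Or44; exists t0.
Qed.

Lemma ladder_rconsE o m a o' k : ladder o (rcons m a) o' k ->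
  exists o1 m' a', [/\ k = rcons m' a', ladder o m o1 m' & sq o1 a a' o'].
Proof.
rewrite -cats1 => /ladder_split[o1 [m' [n' [-> L]]]].
move=> /ladder_consE[a' [o2 [n1 [-> s /ladder_nilE[-> ->]]]]].
by exists o1, m', a'; rewrite -cats1.
Qed.

Lemma ladder_rcons o m o1 m' a a' o2 :
  ladder o m o1 m' -> sq o1 a a' o2 -> ladder o (rcons m a) o2 (rcons m' a').
Proof.
move=> L s; rewrite -!cats1; apply: ladder_cat L _.
by apply: LadderCons s _; exact: LadderNil.
Qed.

(** A swap inside the rail is transported across the ladder, and one involving an end rung merely
    lengthens or shortens the ladder by one square. *)
Lemma far_cancel_swap p q p1 : far_cancel p q -> swap p p1 ->
  exists2 q1, far_cancel p1 q1 & q1 = q \/ swap q q1.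
Proof.
move=> F; elim: F p1 => [o m o' m' t L|x {}p {}q F IH] p1
  /swap_consE[[b [t0 [c [d [e s ->]]]]]|[r S ->]].
- case: m L e => [|b' m] L [] ? ?; subst.
    by case: (ladder_nilE L) s => -> _ /sq_irr.
  have [a' [o1 [m1 [-> s1 L1]]]] := ladder_consE L.
  have [-> ->] := sq_det s s1.
  exists (a' :: m1 ++ t); last by left.
  by apply: FarCancelCons; exact: FarCancelHead.
- case: (swap_around S) => [[m1 S1 ->]|[t1 S1 ->]|[m0 [a [c [d [? s ->]]]]]
    |[b [t0 [c [d [-> s ->]]]]]].
  + have [n' L' S'] := ladder_swap L S1.
    by exists (n' ++ t); [exact: FarCancelHead|right; exact: swap_catr].
  + by exists (m' ++ t1); [exact: FarCancelHead|right; exact: swap_catl].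
  (* The closing edge moves to the left past the last edge of the rail: the ladder loses its last
     square. *)
  + subst; have [o1 [m1 [a' [-> L1 /sq_turn s1]]]] := ladder_rconsE L.
    have [-> ->] := sq_det s s1.
    exists (rcons m1 a' ++ t); last by left.
    by rewrite cat_rcons; exact: FarCancelHead.
  (* The closing edge moves to the right: the ladder gains a square at its end. *)
  + have := sq_rot s; rewrite revK => s1.
    have := FarCancelHead t0 (ladder_rcons L s1).
    by rewrite !cat_rcons revK => ?; exists (m' ++ b :: t0) => //; left.
- subst; case: (far_cancel_consE F) => [[m [o' [m' [t [-> L ->]]]]]|[q1 F1 ->]].
    exists ((x :: m') ++ t); last by left.
    by apply: (@FarCancelHead c (d :: m)); exact: LadderCons (sq_sym s) L.
  exists [:: c, d & q1]; last by right; exact: SwapHead.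
  by do 2 apply: FarCancelCons.
- have [q1 F1 [eq1|?]] := IH _ S.
    by exists (x :: q1); [exact: FarCancelCons|left; rewrite eq1].
  by exists (x :: q1); [exact: FarCancelCons|right; exact: SwapCons].
Qed.

(** If the two cancellations share an edge, their results differ at most by sliding the surviving
    edge through the ladder; otherwise they commute. *)
Lemma far_cancel_confluent p p1 p2 : cancel p p1 -> far_cancel p p2 ->
  reduces p2 p1 \/ exists2 r, far_cancel p1 r & reduces p2 r.
Proof.
move=> C; elim: C p2 => [b t|x {}p {}p1 C IH] p2
  /far_cancel_consE[[m [o' [m' [t0 [e L ->]]]]]|[q F ->]].
- case: m L e => [|b' m] L [].
    move=> _ <-; case: (ladder_nilE L) => _ ->.
    by left; exact: reduces_refl.
  move=> ? _; subst; have [a' [o1 [m1 [_ s _]]]] := ladder_consE L.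
  by case: (sq_irr s).
- case: (far_cancel_consE F) => [[m [o' [m' [t0 [-> L ->]]]]]|[q1 F1 ->]].
    by left; have := ladder_swaps t0 (ladder_rev L); rewrite revK.
  right; exists q1 => //; apply: reduces1; right; exact: CancelHead.
- subst; case: (cancel_around C) => [[m1 C1 ->]|[t1 C1 ->]
    |[m0 [a [? /(can_inj revK) ? ?]]]|[t1 [-> ->]]].
  + have [n' L' S'] := ladder_cancel L C1.
    right; exists (n' ++ t0); first exact: FarCancelHead.
    by apply: reduces1; right; exact: cancel_catr.
  + right; exists (m' ++ t1); first exact: FarCancelHead.
    by apply: reduces1; right; exact: cancel_catl.
  (* Here the last rail edge [a] would equal the rung [o'], and the last square would have a
     backtrack as two consecutive sides. *)
  + subst; have [o1 [m1 [a' [_ _ /sq_turn s1]]]] := ladder_rconsE L.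
    by case: (sq_irr s1).
  + by left; rewrite revK; exact: ladder_swaps_sym.
- case: (IH _ F) => [?|[r ? ?]]; first by left; exact: reduces_cons.
  by right; exists (x :: r); [exact: FarCancelCons|exact: reduces_cons].
Qed.

Lemma reduces_confluent p p1 q :
  reduces p q -> irreducible q -> far_cancel p p1 -> reduces p1 q.
Proof.
move=> R irr.
elim: R p1 irr => [{}p p1 irr /irr//|{}p p1 {}q [S|S] R IH] p2 irr F.
  have [q1 /(IH _ irr) R1 [<-//|S']] := far_cancel_swap F S.
  by apply: (reduces_step _ R1); left.
case: (far_cancel_confluent S F) => [R'|[r /(IH _ irr)]].
  exact: reduces_trans R' R.
by move=> R1 R2; exact: reduces_trans R2 R1.
Qed.

(** For a fixed irreducible [r], reducibility to [r] is invariant under every elementary step: swaps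
    are reversible, and cancellations are handled by [reduces_confluent]. *)
Lemma church_rosser p q : equivalent p q -> irreducible q -> reduces p q.
Proof.
move=> eqv irr.
suff H r : irreducible r -> reduces p r <-> reduces q r.
  by apply/(H _ irr); exact: reduces_refl.
elim: eqv r {irr} => {p q} [p q S|p|p q _ IH|p q r _ IH1 _ IH2] s irr //.
- split=> R; last exact: reduces_step S R.
  case: S => S; first by apply: reduces_step R; left; exact: swap_inv.
  exact: reduces_confluent R irr (cancel_far S).
- by split=> /(IH _ irr).
- by split=> [/(IH1 _ irr)/(IH2 _ irr)|/(IH2 _ irr)/(IH1 _ irr)].
Qed.

(** * Concatenation and inversion of paths up to equivalence *)

Lemma reduction_step_cat s t p q :
  reduction_step p q -> reduction_step (s ++ p ++ t) (s ++ q ++ t).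
Proof.
by move=> [S|S]; [left; apply/swap_catl/swap_catr
  |right; apply/cancel_catl/cancel_catr].
Qed.

Lemma equivalent_cat s t p q :
  equivalent p q -> equivalent (s ++ p ++ t) (s ++ q ++ t).
Proof.
elim=> [p1 q1 S|p1|p1 q1 _|p1 q1 r1 _ IH1 _].
- by apply: Relation_Operators.rst_step; exact: reduction_step_cat.
- exact: Relation_Operators.rst_refl.
- exact: Relation_Operators.rst_sym.
- exact: Relation_Operators.rst_trans.
Qed.

Definition path_rev (p : seq E) : seq E := map rev (seq.rev p).

Lemma path_revK : involutive path_rev.
Proof. by move=> p; rewrite /path_rev -map_rev seq.revK mapK. Qed.

Lemma equivalent_path_rev p : equivalent (p ++ path_rev p) [::].
Proof.
elim: p => [|a p IH]; first exact: Relation_Operators.rst_refl.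
apply: (@Relation_Operators.rst_trans _ _ _ [:: a; rev a]).
  have := equivalent_cat [:: a] [:: rev a] IH.
  by rewrite -catA cats1 -map_rcons -rev_cons.
by apply: Relation_Operators.rst_step; right; exact: CancelHead.
Qed.

Lemma equivalent_loop p q : equivalent (p ++ path_rev q) [::] -> equivalent p q.
Proof.
move=> H; apply: (@Relation_Operators.rst_trans _ _ _ (p ++ (path_rev q ++ q))).
  have := equivalent_path_rev (path_rev q); rewrite path_revK => H1.
  apply: Relation_Operators.rst_sym.
  by have := equivalent_cat p [::] H1; rewrite !cats0.
by have := equivalent_cat [::] q H; rewrite /= -catA.
Qed.

End SquareRewriting.

(** * Edge paths and hyperplanes *)

Section EdgePaths.
Variable X : cube_complex.
Implicit Types (x y z : X 0) (o a b c d e : oedge X) (s t : seq (oedge X)).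

Lemma orevK : involutive (@orev X).
Proof. by case=> e b; rewrite /orev /= negbK. Qed.

Lemma osource_rev o : osource (orev o) = otarget o. Proof. by []. Qed.

Lemma otarget_rev o : otarget (orev o) = osource o.
Proof. by rewrite /otarget /osource /= negbK. Qed.

Lemma edge_path_cat x s t z :
  edge_path x (s ++ t) z <-> exists2 y, edge_path x s y & edge_path y t z.
Proof.
elim: s x => [|o s IH] x /=.
  by split=> [?|[y -> //]]; exists x.
split=> [[? /IH[y ? ?]]|[y [? ?] ?]]; first by exists y.
by split=> //; apply/IH; exists y.
Qed.

Lemma edge_path_rev x s y :
  edge_path x s y -> edge_path y (path_rev (@orev X) s) x.
Proof.
elim: s x => [|o s IH] x /= => [->//|[<- /IH H]].
rewrite /path_rev rev_cons map_rcons -cats1; apply/edge_path_cat.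
by exists (otarget o) => //=; rewrite osource_rev otarget_rev.
Qed.

Lemma walk_edge_path x y (w : seq (X 0)) : @walk (skeleton X) x w y ->
  exists2 s, edge_path x s y & size s = size w.
Proof.
elim: w x => [|z w IH] x /=; first by exists [::].
by move=> [[o <- <-] /IH[s ? <-]]; exists (o :: s).
Qed.

Lemma edge_path_walk x y s : edge_path x s y ->
  exists2 w, @walk (skeleton X) x w y & size w = size s.
Proof.
elim: s x => [|o s IH] x /=; first by exists [::].
move=> [<- /IH[w ? <-]]; exists (otarget o :: w) => //=.
by split=> //; exists o.
Qed.

(* [square_sides a b c d] means that [a, b] and [c, d] are the two paths
   joining opposite corners along the boundary of a square. *)
Inductive square_sides : oedge X -> oedge X -> oedge X -> oedge X -> Prop :=
  | SquareSides01 (q : X 2) (e0 e1 : bool) :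
      square_sides (face e1 ord_max q, e0) (face (~~ e0) ord0 q, e1)
                   (face e0 ord0 q, e1) (face (~~ e1) ord_max q, e0)
  | SquareSides10 (q : X 2) (e0 e1 : bool) :
      square_sides (face e0 ord0 q, e1) (face (~~ e1) ord_max q, e0)
                   (face e1 ord_max q, e0) (face (~~ e0) ord0 q, e1).

Lemma square_sides_sym a b c d : square_sides a b c d -> square_sides c d a b.
Proof. by case=> *; [exact: SquareSides10|exact: SquareSides01]. Qed.

Lemma square_sides_rot a b c d :
  square_sides a b c d -> square_sides (orev a) c b (orev d).
Proof.
case=> q e0 e1; rewrite /orev /=.
  by have := SquareSides01 q (~~ e0) e1; rewrite negbK.
by have := SquareSides10 q e0 (~~ e1); rewrite negbK.
Qed.

Lemma face_face2 (q : X 2) (e0 e1 : bool) :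
  face e0 ord0 (face e1 ord_max q) = face e1 ord0 (face e0 ord0 q).
Proof.
have := @face_face X 0 e0 e1 ord0 ord0 q isT.
by congr (face _ _ (face _ _ _) = face _ _ (face _ _ _)); apply: val_inj.
Qed.

Lemma square_sides_source a b c d :
  square_sides a b c d -> osource a = osource c.
Proof. by case=> *; rewrite /osource /= face_face2. Qed.

Lemma square_sides_middle a b c d :
  square_sides a b c d -> otarget a = osource b.
Proof. by case=> *; rewrite /osource /otarget /= face_face2. Qed.

Lemma square_sides_target a b c d :
  square_sides a b c d -> otarget b = otarget d.
Proof. by case=> *; rewrite /otarget /= face_face2. Qed.

Lemma homotopic_equivalent x y s t :
  homotopic x y s t -> equivalent (@orev X) square_sides s t.
Proof.
elim=> [p q [_ _ H]|p|p q _|p q r _ IH1 _ IH2].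
- case: H => [s' t' o|s' t' c].
    have := @equivalent_cat _ (@orev X) square_sides s' t' [:: o; orev o] [::].
    apply; apply: Relation_Operators.rst_step; right; exact: CancelHead.
  apply: equivalent_cat; apply: Relation_Operators.rst_step; left.
  exact/SwapHead/(SquareSides01 c false false).
- exact: Relation_Operators.rst_refl.
- exact: Relation_Operators.rst_sym.
- exact: Relation_Operators.rst_trans IH1 IH2.
Qed.

Lemma ladder_paths o m o' m' : ladder square_sides o m o' m' ->
  edge_path (otarget o) m (otarget o') /\ edge_path (osource o) m' (osource o').
Proof.
elim=> [//|{}o a a' o1 {}m {}o' {}m' s _ [H1 H2]] /=.
rewrite -(square_sides_middle s) (square_sides_target s).
have s' := square_sides_sym s.
by rewrite (square_sides_source s) (square_sides_middle s').
Qed.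

End EdgePaths.

(** * Walks, and lists over types without decidable equality *)

Lemma walk_cat (G : graph) (x z : G) s t :
  walk x (s ++ t) z <-> exists2 y, walk x s y & walk y t z.
Proof.
elim: s x => [|o s IH] x /=; first by split=> [?|[y -> //]]; exists x.
split=> [[? /IH[y ? ?]]|[y [? ?] ?]]; first by exists y.
by split=> //; apply/IH; exists y.
Qed.

Lemma graph_distE (G : graph) (x y : G) s : walk x s y ->
  (forall t, walk x t y -> size s <= size t) -> graph_dist x y = size s.
Proof.
move=> w min; rewrite /graph_dist; apply: xget_unique.
  by split=> //; exists s.
move=> n [[t /min le_st <-] /(_ _ w) le_ts].
by apply/eqP; rewrite eqn_leq le_st le_ts.
Qed.

Lemma In_filter (T : Type) (p : pred T) (s : seq T) x :
  List.In x (filter p s) <-> List.In x s /\ p x.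
Proof.
elim: s => [|y s IH] /=; first by split=> [//|[]].
case: ifP => py /=; split.
- by case=> [<-|/IH[? ?]]; split=> //; [left|right].
- by case=> -[->|? ?]; [left|right; apply/IH].
- by move/IH => [? ?]; split=> //; right.
- by case=> -[<-|? ?]; [rewrite py|apply/IH].
Qed.

Lemma In_map (S T : Type) (f : S -> T) (s : seq S) y :
  List.In y (map f s) <-> exists2 x, List.In x s & f x = y.
Proof.
elim: s => [|x s IH] /=; first by split=> // -[].
split=> [[<-|/IH[z ? ?]]|[z [->|? fz]]]; first by exists x => //; left.
- by exists z => //; right.
- by left.
- by right; apply/IH; exists z.
Qed.

Lemma In_cat (T : Type) (s t : seq T) x :
  List.In x (s ++ t) <-> List.In x s \/ List.In x t.
Proof.
elim: s => [|y s IH] /=; first by split; [right|case].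
by rewrite IH or_assoc.
Qed.

Lemma In_last (T : Type) (x : T) (s : seq T) : List.In (last x s) (x :: s).
Proof. by elim: s x => [|y s IH] x /=; [left|right; exact: IH]. Qed.

Lemma size_length (T : Type) (s : seq T) : List.length s = size s.
Proof. by elim: s => //= ? ? ->. Qed.

(** * Hyperplanes and the parity of crossings *)

Section HyperplaneTrees.
Variables (X : cube_complex) (colour : X 1 -> nat) (dim : nat).
Local Notation sq := (@square_sides X).
Local Notation rev := (@orev X).
Hypothesis connX : simply_connected X.
Hypothesis sq_det : forall a b c d c' d' : oedge X,
  sq a b c d -> sq a b c' d' -> c = c' /\ d = d'.
Hypothesis sq_irr : forall a c d : oedge X, ~ sq a (orev a) c d.
Hypothesis sq_cube : forall o a a' o1 b b' o2 d e : oedge X,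
  sq o a a' o1 -> sq o1 b b' o2 -> sq a b d e ->
  exists d' o1' e', [/\ sq o d d' o1', sq o1' e e' o2 & sq a' b' d' e'].
Hypothesis colour_parallel : forall a b c d : oedge X,
  sq a b c d -> colour a.1 = colour d.1.
Hypothesis colour_transverse : forall a b c d : oedge X,
  sq a b c d -> colour a.1 != colour b.1.
Hypothesis colour_bounded : forall e, colour e < dim.

Implicit Types (x y z : X 0) (o a b c d e : oedge X) (s t : seq (oedge X)).

(** The classes are the oriented hyperplanes; [same_hyperplane] forgets the orientation. *)
Definition parallel o o' : Prop := exists m m', ladder sq o m o' m'.

Lemma parallel_refl o : parallel o o.
Proof. by exists [::], [::]; exact: LadderNil. Qed.

Lemma parallel_sym o o' : parallel o o' -> parallel o' o.
Proof.
move=> [m [m' L]].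
have := ladder_back (@orevK X) (@square_sides_sym X) (@square_sides_rot X) L.
by exists (map rev (seq.rev m)), (map rev (seq.rev m')).
Qed.

Lemma parallel_trans o1 o2 o3 :
  parallel o1 o2 -> parallel o2 o3 -> parallel o1 o3.
Proof.
move=> [m [m' L]] [n [n' L']].
by exists (m ++ n), (m' ++ n'); exact: ladder_cat L L'.
Qed.

Lemma parallel_rev o o' : parallel o o' -> parallel (orev o) (orev o').
Proof.
by move=> [m [m' L]]; exists m', m; apply: ladder_rev L; exact: square_sides_rot.
Qed.

Lemma square_parallel a b c d : sq a b c d -> parallel a d.
Proof.
by move=> s; exists [:: b], [:: c]; apply: LadderCons s _; exact: LadderNil.
Qed.

(** Rungs are opposite edges of squares, and each rail edge is adjacent to a rung in a square. *)
Lemma ladder_colours o m o' m' : ladder sq o m o' m' ->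
  [/\ colour o'.1 = colour o.1, all (fun e => colour e.1 != colour o.1) m
    & all (fun e => colour e.1 != colour o.1) m'].
Proof.
elim=> [//|{}o a a' o1 {}m {}o' {}m' s _ [-> H1 H2]] /=.
have -> : colour o1.1 = colour o.1 by rewrite (colour_parallel s).
rewrite -(colour_parallel s) in H1 H2; split=> //.
  by rewrite H1 eq_sym (colour_transverse s).
rewrite H2 (colour_parallel s).
by rewrite (colour_transverse (square_sides_sym s)).
Qed.

Definition same_hyperplane o o' : Prop := parallel o o' \/ parallel o (orev o').

Lemma same_hyperplane_refl o : same_hyperplane o o.
Proof. by left; exact: parallel_refl. Qed.

Lemma same_hyperplane_rev o : same_hyperplane o (orev o).
Proof. by right; rewrite orevK; exact: parallel_refl. Qed.

Lemma same_hyperplane_sym o o' : same_hyperplane o o' -> same_hyperplane o' o.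
Proof.
case=> [/parallel_sym|/parallel_sym/parallel_rev]; first by left.
by rewrite orevK; right.
Qed.

Lemma same_hyperplane_trans o1 o2 o3 :
  same_hyperplane o1 o2 -> same_hyperplane o2 o3 -> same_hyperplane o1 o3.
Proof.
case=> H1 [H2|H2].
- by left; exact: parallel_trans H1 H2.
- by right; exact: parallel_trans H1 H2.
- by right; apply: parallel_trans H1 (parallel_rev H2).
- by left; have := parallel_trans H1 (parallel_rev H2); rewrite orevK.
Qed.

Lemma parallel_colour o o' : parallel o o' -> colour o'.1 = colour o.1.
Proof. by move=> [m [m' /ladder_colours[]]]. Qed.

Lemma same_hyperplane_colour o o' :
  same_hyperplane o o' -> colour o'.1 = colour o.1.
Proof. by case=> /parallel_colour. Qed.

Definition hyperplane o : set (oedge X) := [set e | same_hyperplane o e].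

Lemma hyperplaneP o o' : hyperplane o = hyperplane o' <-> same_hyperplane o o'.
Proof.
split=> [E|H].
  suff : hyperplane o o' by [].
  by rewrite E; exact: same_hyperplane_refl.
apply/seteqP; split=> e /=; last exact: same_hyperplane_trans.
by apply: same_hyperplane_trans; exact: same_hyperplane_sym.
Qed.

Definition crossings o s : nat := count (fun e => `[< same_hyperplane o e >]) s.

Lemma crossings_eq0 o s :
  (forall e, List.In e s -> ~ same_hyperplane o e) -> crossings o s = 0.
Proof.
elim: s => //= e s IH H; rewrite /crossings /= -/(crossings o s) IH => [|f ?].
  by case: asboolP => // /H; case; left.
by apply: H; right.
Qed.

Lemma crossings_gt0 o s :
  0 < crossings o s -> exists2 e, List.In e s & same_hyperplane o e.
Proof.
move=> lt0; apply: contrapT => H.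
suff : crossings o s = 0 by move=> E; rewrite E in lt0.
by apply: crossings_eq0 => e ? ?; apply: H; exists e.
Qed.

(** A swap exchanges two edges for parallel ones, so the count is unchanged; a cancellation removes
    two edges of one hyperplane. *)
Lemma crossings_equivalent o s t :
  equivalent rev sq s t -> odd (crossings o s) = odd (crossings o t).
Proof.
have eqh e e' : same_hyperplane e e' ->
    `[< same_hyperplane o e >] = `[< same_hyperplane o e' >].
  move=> H; apply: asbool_equiv_eq; split=> H'.
    exact: same_hyperplane_trans H' H.
  exact: same_hyperplane_trans H' (same_hyperplane_sym H).
elim=> {s t} [p q [S|S]|p|p q _ ->|p q r _ -> _ ->] //; elim: S => {p q} //=.
- move=> a b c d u s; rewrite /crossings /=.
  have /eqh -> : same_hyperplane a d by left; exact: square_parallel s.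
  have /eqh -> : same_hyperplane c b.
    by left; exact: square_parallel (square_sides_sym s).
  by rewrite addnCA.
- by move=> x p q _; rewrite /crossings /= !oddD => ->.
- move=> a u; rewrite /crossings /= (eqh _ _ (same_hyperplane_rev a)).
  by rewrite addnA addnn oddD odd_double.
- by move=> x p q _; rewrite /crossings /= !oddD => ->.
Qed.

Lemma path_equivalent x y s t :
  edge_path x s y -> edge_path x t y -> equivalent rev sq s t.
Proof.
move=> Hs Ht; apply: equivalent_loop; first exact: orevK.
apply: (@homotopic_equivalent _ x x); apply: connX.2.
by apply/edge_path_cat; exists y => //; exact: edge_path_rev.
Qed.

Lemma odd_crossings o x y s t : edge_path x s y -> edge_path x t y ->
  odd (crossings o s) = odd (crossings o t).
Proof.
by move=> Hs Ht; apply: crossings_equivalent; exact: path_equivalent Hs Ht.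
Qed.

(** * Geodesics and hyperplanes *)

Definition geodesic x s y : Prop :=
  edge_path x s y /\ forall t, edge_path x t y -> size s <= size t.

Lemma geodesic_catr x s t y : geodesic x (s ++ t) y ->
  exists2 z, edge_path x s z & geodesic z t y.
Proof.
move=> [/edge_path_cat[z Hs Ht] min]; exists z => //; split=> // u Hu.
have /min : edge_path x (s ++ u) y by apply/edge_path_cat; exists z.
by rewrite !size_cat leq_add2l.
Qed.

Lemma geodesic_catl x s t y : geodesic x (s ++ t) y ->
  exists2 z, geodesic x s z & edge_path z t y.
Proof.
move=> [/edge_path_cat[z Hs Ht] min]; exists z => //; split=> // u Hu.
have /min : edge_path x (u ++ t) y by apply/edge_path_cat; exists z.
by rewrite !size_cat leq_add2r.
Qed.

(** The rails of a ladder have the same length, so replacing one by the other keeps the endpoints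
    and saves the two rungs. *)
Lemma far_cancel_path x s t y :
  far_cancel rev sq s t -> edge_path x s y -> edge_path x t y /\ size t < size s.
Proof.
move=> F; elim: F x => [o m o' m' u L|e {}s {}t _ IH] x /=.
  have [_ Hm'] := ladder_paths L.
  have sz : size m' = size m by elim: L => //= *; congr S.
  move=> [<- /edge_path_cat[z Hm /= [Eo]]]; rewrite otarget_rev => Hu.
  split; first by apply/edge_path_cat; exists (osource o').
  by rewrite !size_cat /= sz addnS ltnS leqW.
by move=> [-> /IH[? ?]].
Qed.

Lemma geodesic_irreducible x s y : geodesic x s y -> irreducible rev sq s.
Proof.
move=> [Hs min] t /far_cancel_path/(_ Hs)[/min le_st lt_ts].
by rewrite ltnNge le_st in lt_ts.
Qed.

(* Between two consecutive crossings of a hyperplane, a geodesic would run along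
   the carrier of that hyperplane, since it is the reduced form of a path which
   does; flipping it across the hyperplane would then save two edges. *)
Lemma geodesic_NoDup x s y : geodesic x s y -> List.NoDup (map hyperplane s).
Proof.
elim: s x => [|o s IH] x geo /=; first exact: List.NoDup_nil.
have [z [Ex Ez] geo'] := geodesic_catr (s := [:: o]) geo; subst z.
have nd := IH _ geo'; apply: List.NoDup_cons => //.
move=> /In_map[o' Io' /esym/hyperplaneP H].
have [s1 [s2 E]] := List.in_split o' s Io'; rewrite -/(cat _ _) in E.
(* By induction the tail crosses the hyperplane of [o'] only at [o']. *)
have s1o e : List.In e s1 -> ~ same_hyperplane o e.
  move=> Ie /same_hyperplane_sym H'; move: nd; rewrite E map_cat /= => nd'.
  apply: (List.NoDup_remove_2 _ _ _ nd'); apply/In_cat; left.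
  apply/In_map; exists e => //.
  exact/hyperplaneP/(same_hyperplane_trans H' H).
rewrite E in geo'; have [z geo1 [/= Ez Hs2]] := geodesic_catl geo'; subst z.
case: H => [[m [m' L]]|[m [m' L]]]; have [Hm Hm'] := ladder_paths L.
(* Crossings in the same direction contradict parity: the rail [m'] has the same endpoints as
   [o :: s1], but crosses the hyperplane zero times instead of once. *)
- have Hos1 : edge_path (osource o) (o :: s1) (osource o').
    by split=> //; case: geo1.
  have := odd_crossings o Hm' Hos1.
  rewrite [crossings o m']crossings_eq0 => [|e Ie /same_hyperplane_colour Ec].
    rewrite /crossings /= -/(crossings o s1) crossings_eq0 // addn0.
    by case: asboolP => // -[]; exact: same_hyperplane_refl.
  have [_ _] := ladder_colours L.
  by elim: m' Ie {L Hm'} => //= f m' IHm [->|?] /andP[]; [rewrite Ec eqxx|auto].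
- rewrite osource_rev in Hm'; rewrite otarget_rev in Hm.
  have eqv := path_equivalent Hm (proj1 geo1).
  have R := church_rosser (@orevK X) (@square_sides_sym X) (@square_sides_rot X)
    sq_det sq_irr sq_cube eqv (geodesic_irreducible geo1).
  have [n L'] := ladder_reduces (@orevK X) (@square_sides_sym X)
    (@square_sides_rot X) sq_det sq_cube L R.
  have [_ Hn] := ladder_paths L'; rewrite osource_rev Ex in Hn.
  have sz : size n = size s1 by elim: L' => //= *; congr S.
  have /(proj2 geo) : edge_path x (n ++ s2) y.
    by apply/edge_path_cat; exists (otarget o').
  by rewrite E /= !size_cat /= sz addnS => /ltnW; rewrite ltnn.
Qed.

Lemma geodesic_crossings x s y o :
  geodesic x s y -> List.In o s -> crossings o s = 1.
Proof.
move=> /geodesic_NoDup; elim: s => //= e s IH nd.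
have [nIn nd'] : ~ List.In (hyperplane e) (map hyperplane s) /\
  List.NoDup (map hyperplane s) by inversion nd.
rewrite /crossings /= -/(crossings o s); case=> [<-|Io].
  rewrite crossings_eq0 => [|f If H]; last first.
    by apply: nIn; apply/In_map; exists f => //; exact/esym/hyperplaneP.
  by case: asboolP => // -[]; exact: same_hyperplane_refl.
rewrite IH //; case: asboolP => // H; case: nIn.
by apply/In_map; exists o => //; exact/hyperplaneP.
Qed.

(** * The tree of each colour *)

Definition avoiding (i : nat) x : set (X 0) :=
  [set y | exists2 s, edge_path x s y & all (fun e => colour e.1 != i) s].

(** Quotient vertices are encoded as the classes themselves, that is, the components left after
    deleting the edges of colour [i]. *)
Definition contraction (i : nat) : Type := {A | exists x, A = avoiding i x}.

Definition contract (i : nat) x : contraction i :=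
  exist _ (avoiding i x) (ex_intro _ x erefl).

Definition contracted_graph (i : nat) : graph :=
  @Graph (contraction i) (fun A B => exists o, [/\ colour o.1 = i,
    contract i (osource o) = A & contract i (otarget o) = B]).

Lemma avoiding_sym i x y : avoiding i x y -> avoiding i y x.
Proof.
move=> [s /edge_path_rev Hs avoid]; exists (path_rev rev s) => //.
by rewrite /path_rev all_map all_rev.
Qed.

Lemma avoiding_trans i x y z :
  avoiding i x y -> avoiding i y z -> avoiding i x z.
Proof.
move=> [s Hs ?] [t Ht ?]; exists (s ++ t); first by apply/edge_path_cat; exists y.
by rewrite all_cat; apply/andP.
Qed.

Lemma contractP i x y : contract i x = contract i y <-> avoiding i x y.
Proof.
split=> [/(congr1 sval) /= ->|H]; first by exists [::].
apply: eq_exist; apply/seteqP; split=> z; last exact: avoiding_trans.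
by apply: avoiding_trans; exact: avoiding_sym.
Qed.

Lemma contract_surj i (A : contracted_graph i) : exists x, contract i x = A.
Proof.
by case: A => A HA; case: (HA) => x E; exists x; apply: eq_exist.
Qed.

(** The rail of a ladder avoids the colour of its rungs. With the analogue for targets, an oriented
    hyperplane thus yields a single oriented edge of the quotient. *)
Lemma contract_parallel o o' : parallel o o' ->
  contract (colour o.1) (osource o) = contract (colour o.1) (osource o').
Proof.
move=> [m [m' L]]; have [_ Hm'] := ladder_paths L.
by apply/contractP; exists m' => //; have [] := ladder_colours L.
Qed.

Lemma contract_parallel_target o o' : parallel o o' ->
  contract (colour o.1) (otarget o) = contract (colour o.1) (otarget o').
Proof. by move=> /parallel_rev/contract_parallel. Qed.

Definition coloured (i : nat) s := [seq e <- s | colour e.1 == i].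

Lemma edge_path_contract i x y s : edge_path x s y ->
  exists2 w, @walk (contracted_graph i) (contract i x) w (contract i y)
    & size w = size (coloured i s).
Proof.
elim: s x => [|o s IH] x /=; first by move=> ->; exists [::].
move=> [<- /IH[w Hw sz]]; case: eqP => c; last first.
  exists w => //; suff -> : contract i (osource o) = contract i (otarget o) by [].
  by apply/contractP; exists [:: o] => //=; rewrite andbT; exact/eqP.
by exists (contract i (otarget o) :: w) => /=; [split=> //; exists o|rewrite sz].
Qed.

(** The list [s] need not be a path: it records the edges above the successive steps of [w], without
    the connecting stretches inside the classes. *)
Fixpoint traces (i : nat) (A : contracted_graph i) s
    (w : seq (contracted_graph i)) : Prop :=
  match s, w with
  | o :: s', B :: w' =>
    [/\ contract i (osource o) = A, contract i (otarget o) = B & traces B s' w']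
  | [::], [::] => True
  | _, _ => False
  end.

(** Edges above consecutive steps end and start in the same class, where a path avoiding colour [i]
    joins them. *)
Lemma walk_lift i (A B : contracted_graph i) w x y : walk A w B ->
  contract i x = A -> contract i y = B ->
  exists2 s, edge_path x s y & traces A (coloured i s) w.
Proof.
elim: w A x => [|C w IH] A x /=.
  move=> -> Ex Ey; move: Ey; rewrite -Ex => /esym/contractP[s Hs avoid].
  exists s => //; rewrite /coloured (_ : filter _ _ = [::]) //.
  by elim: s avoid {Hs} => //= e s IH /andP[/negbTE -> /IH].
move=> [[o [Co Eo1 Eo2]] /IH{}IH] Ex Ey; have [s Hs tr] := IH _ Eo2 Ey.
move: Ex; rewrite -Eo1 => /contractP[t Ht avoid].
exists (t ++ o :: s); first by apply/edge_path_cat; exists (osource o).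
rewrite /coloured filter_cat /= Co eqxx (_ : filter _ t = [::]) //.
by elim: t avoid {Ht} => //= e t IHt /andP[/negbTE -> /IHt].
Qed.

Lemma traces_size i (A : contracted_graph i) s w : traces A s w -> size s = size w.
Proof. by elim: s A w => [|o s IH] A [|B w] //= [_ _ /IH ->]. Qed.

Lemma traces_In i (A : contracted_graph i) s w o : traces A s w -> List.In o s ->
  exists w1 B w2, [/\ w = w1 ++ B :: w2, contract i (osource o) = last A w1
    & contract i (otarget o) = B].
Proof.
elim: s A w => [|e s IH] A [|B w] //= [EA EB tr] [<-|Io].
  by exists [::], B, w.
have [w1 [C [w2 [-> ? ?]]]] := IH _ _ tr Io.
by exists (B :: w1), C, w2.
Qed.

(* An edge of the contracted graph comes from a single hyperplane, which a
   simple cycle would cross exactly once. *)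
Lemma contracted_graph_acyclic i : acyclic (contracted_graph i).
Proof.
move=> A w size_w nd Hw [o [Co Eo1 Eo2]].
have [s Hs tr] := walk_lift Hw Eo2 Eo1.
have Hos : edge_path (osource o) (o :: s) (osource o) by [].
have := @odd_crossings o _ _ _ [::] Hos erefl.
rewrite /crossings /= -/(crossings o s) crossings_eq0; last first.
  move=> e Ie H; have Ce := same_hyperplane_colour H.
  have Ie' : List.In e (coloured i s) by apply/In_filter; rewrite Ce Co.
  have [w1 [B [w2 [Ew E1 E2]]]] := traces_In tr Ie'.
  have nA : ~ List.In A w by inversion nd.
  have ndw : List.NoDup w by inversion nd.
  (* If [e] crosses in the direction of [o], its step ends at [A], which [w] does not revisit.
     Otherwise its step goes from [A] to the last vertex of [w]; it must then be the first step, and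
     as [w] has at least two vertices, the last one would be repeated. *)
  case: H => [/contract_parallel_target|P].
    rewrite Co E2 Eo2 => EA; apply: nA; rewrite EA Ew.
    by apply/In_cat; right; left.
  have := contract_parallel_target P; have := contract_parallel P.
  rewrite Co Eo1 Eo2 osource_rev otarget_rev E1 E2 => EB EA.
  case: w1 => [|C w1] in Ew E1 EA.
    case: w2 => [|D w2] in Ew.
      by rewrite Ew in size_w.
    rewrite Ew /= in EB ndw; inversion ndw; case: H1.
    by rewrite -EB; exact: In_last.
  apply: nA; rewrite EA Ew; apply/In_cat; left; exact: In_last.
by case: asboolP => // -[]; exact: same_hyperplane_refl.
Qed.

(** Irreflexivity is again parity: an edge of colour [i] with both ends in one class closes up to a
    loop crossing its hyperplane exactly once. *)
Lemma contracted_graph_tree i : is_tree (contracted_graph i).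
Proof.
split.
- move=> A B [o [? ? ?]]; exists (orev o); split=> //.
  by rewrite otarget_rev.
- move=> A [o [Co <-]] /contractP[s Hs avoid].
  have Hos : edge_path (otarget o) (s ++ [:: o]) (otarget o).
    by apply/edge_path_cat; exists (osource o).
  have := @odd_crossings o _ _ _ [::] Hos erefl.
  rewrite /crossings count_cat /= -/(crossings o s) crossings_eq0; last first.
    move=> e Ie /same_hyperplane_colour Ce; rewrite Co in Ce.
    by elim: s avoid Ie {Hs Hos} => //= f s IH /andP[Cf /IH{}IH] [E|//];
      rewrite E Ce eqxx in Cf.
  by case: asboolP => // -[]; exact: same_hyperplane_refl.
- have [[x] conn] := connX.1; split; first by split; exact: (contract i x).
  move=> A B; have [a <-] := contract_surj A; have [b <-] := contract_surj B.
  have [u /walk_edge_path[s Hs _]] := conn a b.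
  by have [w ? _] := edge_path_contract i Hs; exists w.
- exact: contracted_graph_acyclic.
Qed.

(** Each hyperplane of colour [i] crossed by the geodesic is crossed once, hence an odd number of
    times by the lift of any competing walk. These hyperplanes are distinct, so that walk is at
    least as long. *)
Lemma geodesic_contract i x s y : geodesic x s y ->
  @graph_dist (contracted_graph i) (contract i x) (contract i y) =
  size (coloured i s).
Proof.
move=> geo; have [w Hw sz] := edge_path_contract i geo.1.
rewrite -sz; apply: graph_distE Hw _ => t Ht; rewrite sz {w sz}.
have [u Hu tr] := walk_lift Ht erefl erefl.
rewrite -(traces_size tr) -(size_map hyperplane (coloured i s)).
rewrite -(size_map hyperplane (coloured i u)) -!size_length; apply/leP; apply: List.NoDup_incl_length.
  have := geodesic_NoDup geo; elim: (s) => //= o r IH nd.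
  have {}IH : List.NoDup (map hyperplane (coloured i r)) by apply: IH; inversion nd.
  case: eqP => //= _; apply: List.NoDup_cons => // /In_map[e /In_filter[Ie _] E].
  by inversion nd; apply: H1; apply/In_map; exists e.
move=> _ /In_map[o /In_filter[Io Co] <-].
have : 0 < crossings o u.
  have := odd_crossings o geo.1 Hu.
  by rewrite (geodesic_crossings geo Io); case: crossings.
move=> /crossings_gt0[e Ie H]; apply/In_map; exists e.
  by apply/In_filter; rewrite (same_hyperplane_colour H).
exact/esym/hyperplaneP.
Qed.

Lemma exists_geodesic x y : exists s, geodesic x s y.
Proof.
have [w /walk_edge_path[s0 Hs0 _]] := connX.1.2 x y.
pose P n := `[< exists2 s, edge_path x s y & size s = n >].
have exP : exists n, P n by exists (size s0); apply/asboolP; exists s0.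
case: (ex_minnP exP) => n /asboolP[s Hs <-] min; exists s; split=> // t Ht.
by apply: min; apply/asboolP; exists t.
Qed.

Lemma size_coloured s : size s = \sum_(i < dim) size (coloured i s).
Proof.
elim: s => [|o s IH] /=; first by rewrite big1.
have E : \sum_(i < dim) (colour o.1 == i) = 1; last first.
  rewrite IH -add1n -[X in X + _]E -big_split.
  by apply: eq_bigr => i _ /=; case: eqP.
rewrite (bigD1 (Ordinal (colour_bounded o.1))) //= eqxx big1 // => i ne.
by case: eqP => // E; case/eqP: ne; apply: val_inj.
Qed.

Theorem comb_dist_contract x y : comb_dist x y =
  \sum_(i < dim) @graph_dist (contracted_graph i) (contract i x) (contract i y).
Proof.
have [s geo] := exists_geodesic x y.
under eq_bigr => i _ do rewrite (geodesic_contract i geo).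
have [w Hw sz] := edge_path_walk geo.1.
rewrite -size_coloured -sz /comb_dist; apply: graph_distE Hw _ => t.
by move=> /walk_edge_path[u /geo.2 ? <-]; rewrite sz.
Qed.
End HyperplaneTrees.

(** * Coverings *)

Section Corners.
Variable X : cube_complex.

Lemma skeleton_sym (x y : X 0) : @adj (skeleton X) x y -> @adj (skeleton X) y x.
Proof. by move=> [o <- <-]; exists (orev o) => //; rewrite otarget_rev. Qed.

Definition connected (x y : X 0) : Prop := exists s, @walk (skeleton X) x s y.

Lemma connected_refl x : connected x x.
Proof. by exists [::]. Qed.

Lemma connected_trans x y z : connected x y -> connected y z -> connected x z.
Proof.
by move=> [s Hs] [t Ht]; exists (s ++ t); apply/(@walk_cat (skeleton X)); exists y.
Qed.

Lemma connected_adj x y : @adj (skeleton X) x y -> connected x y.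
Proof. by exists [:: y]. Qed.

Lemma connected_sym x y : connected x y -> connected y x.
Proof.
move=> [s]; elim: s x => [|z s IH] x /=; first by move=> ->; exact: connected_refl.
by move=> [/skeleton_sym/connected_adj H /IH /connected_trans]; apply.
Qed.

Lemma corner_adj n (c : X n.+1) (f : 'I_n -> bool) b :
  @adj (skeleton X) (corner (face b ord0 c) f) (corner (face (~~ b) ord0 c) f).
Proof.
elim: n c f => [|n IH] c f /=; first by exists (c, b).
have E e : face (f ord0) ord0 (face e ord0 c) =
    face e ord0 (face (f ord0) (lift ord0 ord0) c).
  by rewrite face_face //; congr (face _ _ (face _ _ _)); apply: val_inj.
by rewrite !E; exact: IH.
Qed.

Lemma corner_connected n (c : X n) e f : connected (corner c e) (corner c f).
Proof.
elim: n c e f => [|n IH] c e f /=; first exact: connected_refl.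
apply: connected_trans (IH _ _ (fun i => f (lift ord0 i))) _.
have [->|ne] := eqVneq (e ord0) (f ord0); first exact: connected_refl.
have -> : f ord0 = ~~ e ord0 by case: (e _) (f _) ne => [] [].
exact/connected_adj/corner_adj.
Qed.

End Corners.

Section Coverings.
Variables (X Y : cube_complex) (p : forall n, X n -> Y n).
Hypothesis cov : is_covering p.

Definition push (o : oedge X) : oedge Y := (p o.1, o.2).

Lemma push_source (o : oedge X) : osource (push o) = p (osource o).
Proof. by rewrite /osource covering_face. Qed.

(** Uniqueness of the lift of a 1-cube with prescribed source. *)
Lemma push_inj (o o' : oedge X) :
  push o = push o' -> osource o = osource o' -> o = o'.
Proof.
case: o o' => [e b] [e' b'] [E <-] Es.
have H : corner (p e) (fun=> b) = p (osource (e, b)).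
  by rewrite /= -(covering_face cov).
have [x [_ uniq]] := covering_lift cov H.
by rewrite -(uniq e) ?(uniq e') //; split=> //; rewrite -Es.
Qed.

Lemma push_sides (a b c d : oedge X) : square_sides a b c d ->
  square_sides (push a) (push b) (push c) (push d).
Proof.
by case=> q e0 e1; rewrite /push /= !(covering_face cov);
  [exact: SquareSides01|exact: SquareSides10].
Qed.

Lemma square_lift (q : Y 2) (e0 e1 : bool) (x : X 0) :
  face e0 ord0 (face e1 ord_max q) = p x ->
  exists2 q', face e0 ord0 (face e1 ord_max q') = x & p q' = q.
Proof.
move=> H; have : corner q (fun i => if i == ord0 then e0 else e1) = p x.
  by rewrite -H face_face2.
by move=> /(covering_lift cov)[q' [[<- <-] _]]; exists q' => //; rewrite face_face2.
Qed.

(** The square is lifted at the source of [a]; by uniqueness of edge lifts, its first two sides are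
    [a] and then [b]. *)
Lemma sides_lift (a b : oedge X) (c0 d0 : oedge Y) : otarget a = osource b ->
  square_sides (push a) (push b) c0 d0 ->
  exists c d, [/\ push c = c0, push d = d0 & square_sides a b c d].
Proof.
move=> Eab H.
have lift_edge o (e : X 1) (b0 : bool) :
    push o = (p e, b0) -> osource o = face b0 ord0 e -> o = (e, b0).
  exact: (@push_inj o (e, b0)).
have [a0 Ea] : exists a0 : oedge Y, push a = a0 by exists (push a).
have [b0 Eb] : exists b0 : oedge Y, push b = b0 by exists (push b).
rewrite Ea Eb in H; case: H Ea Eb => q e0 e1 Ea Eb.
- have [|q' Eq' Eq] := @square_lift q e0 e1 (osource a).
    by rewrite -push_source Ea.
  exists (face e0 ord0 q', e1), (face (~~ e1) ord_max q', e0).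
  rewrite /push /= !(covering_face cov) Eq; split=> //.
  have Ea' : a = (face e1 ord_max q', e0).
    by apply: lift_edge; rewrite ?(covering_face cov) ?Eq.
  have -> : b = (face (~~ e0) ord0 q', e1).
    apply: lift_edge; first by rewrite (covering_face cov) Eq.
    by rewrite -Eab Ea' /otarget /= face_face2.
  by rewrite Ea'; exact: SquareSides01.
- have [|q' Eq' Eq] := @square_lift q e0 e1 (osource a).
    by rewrite -push_source Ea /osource /= face_face2.
  exists (face e1 ord_max q', e0), (face (~~ e0) ord0 q', e1).
  rewrite /push /= !(covering_face cov) Eq; split=> //.
  have Ea' : a = (face e0 ord0 q', e1).
    by apply: lift_edge; rewrite ?(covering_face cov) ?Eq // -Eq' face_face2.
  have -> : b = (face (~~ e1) ord_max q', e0).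
    apply: lift_edge; first by rewrite (covering_face cov) Eq.
    by rewrite -Eab Ea' /otarget /= face_face2.
  by rewrite Ea'; exact: SquareSides10.
Qed.

Lemma covering_sides_det :
  (forall a b c d c' d' : oedge Y, square_sides a b c d ->
    square_sides a b c' d' -> c = c' /\ d = d') ->
  forall a b c d c' d' : oedge X, square_sides a b c d -> square_sides a b c' d' ->
    c = c' /\ d = d'.
Proof.
move=> det a b c d c' d' s s'.
have [Ec Ed] := det _ _ _ _ _ _ (push_sides s) (push_sides s').
have {}Ec : c = c'.
  apply: push_inj Ec _.
  by rewrite -(square_sides_source s) (square_sides_source s').
split=> //; apply: push_inj Ed _.
rewrite -(square_sides_middle (square_sides_sym s)).
by rewrite -(square_sides_middle (square_sides_sym s')) Ec.
Qed.

(** The three opposite squares are lifted one by one; the edges they should share have equal images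
    and equal sources, hence agree. *)
Lemma covering_sides_cube :
  (forall o a a' o1 b b' o2 d e : oedge Y, square_sides o a a' o1 ->
    square_sides o1 b b' o2 -> square_sides a b d e ->
    exists d' o1' e', [/\ square_sides o d d' o1', square_sides o1' e e' o2
      & square_sides a' b' d' e']) ->
  forall o a a' o1 b b' o2 d e : oedge X, square_sides o a a' o1 ->
    square_sides o1 b b' o2 -> square_sides a b d e ->
    exists d' o1' e', [/\ square_sides o d d' o1', square_sides o1' e e' o2
      & square_sides a' b' d' e'].
Proof.
move=> cube o a a' o1 b b' o2 d e s1 s2 s3.
have [d0 [o0 [e0 [t1 t2 t3]]]] := cube _ _ _ _ _ _ _ _ _
  (push_sides s1) (push_sides s2) (push_sides s3).
have Eod : otarget o = osource d.
  by rewrite (square_sides_middle s1) (square_sides_source s3).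
have [d' [o1' [Ed Eo u1]]] := sides_lift Eod t1.
have Eo1e : otarget o1' = osource e.
  by rewrite -(square_sides_target u1) (square_sides_middle (square_sides_sym s3)).
rewrite -Eo in t2; have [e' [o2' [Ee Eo2 u2]]] := sides_lift Eo1e t2.
have Eab : otarget a' = osource b'.
  by rewrite (square_sides_middle (square_sides_sym s1)) (square_sides_source s2).
have [d2 [e2 [Ed2 Ee2 u3]]] := sides_lift Eab t3.
have Ed' : d2 = d'.
  apply: push_inj; first by rewrite Ed2.
  rewrite -(square_sides_source u3) -(square_sides_source u1).
  by rewrite (square_sides_source s1).
have Ee' : e2 = e'.
  apply: push_inj; first by rewrite Ee2.
  rewrite -(square_sides_middle (square_sides_sym u3)) Ed'.
  by rewrite (square_sides_middle (square_sides_sym u1)) (square_sides_source u2).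
have Eo2' : o2' = o2.
  apply: push_inj => //.
  rewrite -(square_sides_middle (square_sides_sym u2)) -Ee'.
  rewrite -(square_sides_target u3).
  by rewrite (square_sides_middle (square_sides_sym s2)).
by exists d', o1', e'; rewrite -Ed' -Ee' -{1}Eo2' {1}Ed' {1}Ee'.
Qed.

End Coverings.

Lemma sval_inj (T : Type) (Q : T -> Prop) : injective (@sval T Q).
Proof. by case=> x Qx [y Qy] /= H; exact: eq_exist. Qed.

Lemma sval_corner (X : cube_complex) (x : X 0) n (c : component x n) e :
  sval (corner c e) = corner (sval c) e.
Proof. by elim: n c e => [|n IH] c e //=; rewrite IH. Qed.

Lemma in_component_connected (X : cube_complex) (x : X 0) n (c : X n) e :
  connected x (corner c e) -> in_component x c.
Proof. by move=> H f; exact: connected_trans H (corner_connected c e f). Qed.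

(** A cube with one corner in the component lies in it entirely, so a lifting problem over [Y] is
    one over the component. *)
Lemma covering_component (X Y : cube_complex) (y : Y 0)
    (p : forall n, X n -> component y n) :
  is_covering p -> is_covering (fun n c => sval (p n c) : Y n).
Proof.
move=> cov; split=> [n e i c|n c e x E]; first by rewrite (covering_face cov).
have [s Hs] := svalP (p 0 x) (fun=> false); have Hc : in_component y c.
  by apply: (@in_component_connected _ _ _ _ e); exists s; rewrite E.
have E' : corner (exist _ c Hc : component y n) e = p 0 x.
  by apply: sval_inj; rewrite sval_corner.
have [c' [[E1 E2] uniq]] := covering_lift cov E'.
exists c'; split=> [|c2 [F1 F2]]; first by rewrite E2.
by apply: uniq; split=> //; exact: sval_inj.
Qed.

(** * Squares of the Squier complex *)

Section SquierGeometry.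
Variables (Sigma : Type) (P : presentation Sigma).
Local Notation S := (squier_complex P).
Local Notation rule := {r : seq Sigma * seq Sigma | relations P r.1 r.2}.
Implicit Types (x y z u v : seq Sigma) (r s t : rule) (e f g : bool).

(* The oriented edge [(x, r, y), e] rewrites [side r e] into [side r (~~ e)]. *)
Definition side r e : seq Sigma := if e then (sval r).2 else (sval r).1.

Definition move x r y e : oedge S := ((x, r, y), e).

Lemma move_inj x r y e x' r' y' e' : move x r y e = move x' r' y' e' ->
  [/\ x = x', r = r', y = y' & e = e'].
Proof. by case. Qed.

Lemma side_gt0 r e : 0 < size (side r e).
Proof.
case: r => [[u v] /= rel]; have [nu nv] := relations_neq1 rel; rewrite /side /=.
by case: e; [case: v nv {rel}|case: u nu {rel}].
Qed.

(** The moves [a] and [d] rewrite the left factor, [b] and [c] the right one, and [y] is the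
    untouched word between them. *)
Definition independent (a b c d : oedge S) : Prop :=
  exists x r e y s f z,
    [/\ a = move x r (y ++ side s f ++ z) e,
        b = move (x ++ side r (~~ e) ++ y) s z f,
        c = move (x ++ side r e ++ y) s z f
      & d = move x r (y ++ side s (~~ f) ++ z) e].

Lemma square_sidesE (a b c d : oedge S) :
  square_sides a b c d <-> independent a b c d \/ independent c d a b.
Proof.
split.
- by case=> -[[x r] [[y s] z]] e f; [left|right]; exists x, r, e, y, s, f, z;
    split; rewrite /move /= !catA.
- by case=> -[x [r [e [y [s [f [z [-> -> -> ->]]]]]]]]; rewrite /move !catA;
    [exact: (@SquareSides01 S ((x, r), ((y, s), z)))
    |exact: (@SquareSides10 S ((x, r), ((y, s), z)))].
Qed.

Lemma cat_injl (T : Type) (u v w : seq T) : u ++ v = u ++ w -> v = w.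
Proof. exact: List.app_inv_head. Qed.

(** As sides of relations are non-empty, the lengths of the prefixes of [a] and [b] tell which move
    is on the left; cancelling words then determines the middle part. *)
Lemma squier_sides_det (a b c d c' d' : oedge S) :
  square_sides a b c d -> square_sides a b c' d' -> c = c' /\ d = d'.
Proof.
move=> /square_sidesE[] [x [r [e [y [s [f [z [-> -> -> ->]]]]]]]].
- move=> /square_sidesE[] [x' [r' [e' [y' [s' [f' [z' H]]]]]]].
    case: H => /move_inj[? ? _ ?] /move_inj[E ? ? ?] -> ->; subst.
    by have /cat_injl/cat_injl -> := E.
  case: H => -> -> /move_inj[E1 _ _ _] /move_inj[E2 _ _ _].
  move: E1 E2 => /(congr1 size) E1 /(congr1 size); rewrite !size_cat in E1 *.
  have := side_gt0 r (~~ e); lia.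
- move=> /square_sidesE[] [x' [r' [e' [y' [s' [f' [z' H]]]]]]].
    case: H => /move_inj[E1 _ _ _] /move_inj[E2 _ _ _] _ _.
    move: E1 E2 => /(congr1 size) E1 /(congr1 size); rewrite !size_cat in E1 *.
    have := side_gt0 r' (~~ e'); lia.
  case: H => -> -> /move_inj[E ? ? ?] /move_inj[? ? _ ?]; subst.
  by have /cat_injl/cat_injl -> := E.
Qed.

(** An edge and its reverse have the same prefix, whereas consecutive sides of a square have
    prefixes of different lengths. *)
Lemma squier_sides_irr (a c d : oedge S) : ~ square_sides a (orev a) c d.
Proof.
have neq x r e y : x <> x ++ side r e ++ y.
  by move=> /(congr1 size); rewrite !size_cat; have := side_gt0 r e; lia.
move=> /square_sidesE[] [x [r [e [y [s [f [z H]]]]]]].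
  by case: H => -> /move_inj[/neq].
by case: H => _ _ -> /move_inj[/esym/neq].
Qed.

(** The words enter through equations, to be matched up to associativity. *)
Lemma sides_lr x r e y s f z v v' w w' :
  v = y ++ side s f ++ z -> v' = y ++ side s (~~ f) ++ z ->
  w = x ++ side r e ++ y -> w' = x ++ side r (~~ e) ++ y ->
  square_sides (move x r v e) (move w' s z f) (move w s z f) (move x r v' e).
Proof.
by move=> -> -> -> ->; apply/square_sidesE; left; exists x, r, e, y, s, f, z.
Qed.

Lemma sides_rl x r e y s f z v v' w w' :
  v = y ++ side s f ++ z -> v' = y ++ side s (~~ f) ++ z ->
  w = x ++ side r e ++ y -> w' = x ++ side r (~~ e) ++ y ->
  square_sides (move w s z f) (move x r v' e) (move x r v e) (move w' s z f).
Proof. by move=> *; apply: square_sides_sym; exact: (@sides_lr _ _ _ y). Qed.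

Lemma squier_sides_cube (o a a' o1 b b' o2 d e : oedge S) :
  square_sides o a a' o1 -> square_sides o1 b b' o2 -> square_sides a b d e ->
  exists d' o1' (e' : oedge S), [/\ square_sides o d d' o1',
    square_sides o1' e e' o2 & square_sides a' b' d' e'].
Proof.
(* The eight cases are the relative positions of the moves [o], [a] and [b] in
   the word; two of them are cyclic, hence impossible. *)
move=> /square_sidesE[] [x1 [r1 [e1 [y1 [s1 [f1 [z1 [-> -> -> ->]]]]]]]]
  /square_sidesE[] [x2 [r2 [e2 [y2 [s2 [f2 [z2 H2]]]]]]]
  /square_sidesE[] [x3 [r3 [e3 [y3 [s3 [f3 [z3 H3]]]]]]].
- case: H2 H3 => /move_inj[? ? E2 ?] -> -> ->.
  case=> /move_inj[? ? E3 ?] /move_inj[E4 ? ? ?] -> ->; subst.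
  move: E4; rewrite -!catA => /cat_injl/cat_injl ?; subst.
  (* In every case, [d'] is the move of [b] made before those of [o] and [a], [o1'] the move of [o]
     made after that of [b] but before that of [a], and [e'] the move of [a] made before that of [o]
     and after that of [b]. *)
  exists (move (x2 ++ side r2 e2 ++ y1 ++ side r3 e3 ++ y3) s3 z3 f3),
    (move x2 r2 (y1 ++ side r3 e3 ++ y3 ++ side s3 (~~ f3) ++ z3) e2),
    (move (x2 ++ side r2 e2 ++ y1) r3 (y3 ++ side s3 (~~ f3) ++ z3) e3).
  split.
  + by apply: (@sides_lr _ _ _ (y1 ++ side r3 e3 ++ y3)); rewrite -?catA.
  + by apply: (@sides_lr _ _ _ y1); rewrite -?catA.
  + by apply: (@sides_lr _ _ _ y3); rewrite -?catA.
- case: H2 H3 => /move_inj[? ? E2 ?] -> -> ->.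
  case=> -> -> /move_inj[E4 ? ? ?] /move_inj[? ? E3 ?]; subst.
  move: E4; rewrite -!catA => /cat_injl/cat_injl ?; subst.
  exists (move (x2 ++ side r2 e2 ++ y2) r3 (y3 ++ side s3 f3 ++ z3) e3),
    (move x2 r2 (y2 ++ side r3 (~~ e3) ++ y3 ++ side s3 f3 ++ z3) e2),
    (move (x2 ++ side r2 e2 ++ y2 ++ side r3 (~~ e3) ++ y3) s3 z3 f3).
  split.
  + by apply: (@sides_lr _ _ _ y2); rewrite -?catA.
  + by apply: (@sides_lr _ _ _ (y2 ++ side r3 (~~ e3) ++ y3)); rewrite -?catA.
  + by apply: (@sides_rl _ _ _ y3); rewrite -?catA.
- case: H2 H3 => -> -> /move_inj[/(congr1 size) E1 _ _ _] ->.
  case=> /move_inj[/(congr1 size) E3 _ _ _] /move_inj[/(congr1 size) E4 _ _ _] _ _.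
  exfalso; move: E1 E3 E4; rewrite !size_cat.
  have := (side_gt0 r1 (~~ e1)); lia.
- case: H2 H3 => -> -> /move_inj[E2 ? ? ?] ->.
  case=> -> -> /move_inj[E3 ? ? ?] /move_inj[? ? E4 ?]; subst.
  move: E3 {E4}; rewrite -!catA => /cat_injl/cat_injl ?; subst.
  exists (move x3 r3 (y2 ++ side s2 f2 ++ y1 ++ side s3 f3 ++ z3) e3),
    (move (x3 ++ side r3 (~~ e3) ++ y2) s2 (y1 ++ side s3 f3 ++ z3) f2),
    (move (x3 ++ side r3 (~~ e3) ++ y2 ++ side s2 f2 ++ y1) s3 z3 f3).
  split.
  + by apply: (@sides_rl _ _ _ y2); rewrite -?catA.
  + by apply: (@sides_lr _ _ _ y1); rewrite -?catA.
  + by apply: (@sides_rl _ _ _ (y2 ++ side s2 f2 ++ y1)); rewrite -?catA.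
- case: H2 H3 => /move_inj[E2 ? ? ?] -> -> ->.
  case=> /move_inj[? ? E3 ?] /move_inj[E4 ? ? ?] -> ->; subst.
  move: E4 {E3}; rewrite -!catA => /cat_injl/cat_injl ?; subst.
  exists (move (x3 ++ side r3 e3 ++ y1 ++ side r2 e2 ++ y2) s3 z3 f3),
    (move (x3 ++ side r3 e3 ++ y1) r2 (y2 ++ side s3 (~~ f3) ++ z3) e2),
    (move x3 r3 (y1 ++ side r2 e2 ++ y2 ++ side s3 (~~ f3) ++ z3) e3).
  split.
  + by apply: (@sides_lr _ _ _ y2); rewrite -?catA.
  + by apply: (@sides_rl _ _ _ y1); rewrite -?catA.
  + by apply: (@sides_lr _ _ _ (y1 ++ side r2 e2 ++ y2)); rewrite -?catA.
- case: H2 H3 => /move_inj[/(congr1 size) E1 _ _ _] -> -> _.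
  case=> _ _ /move_inj[/(congr1 size) E3 _ _ _] /move_inj[/(congr1 size) E4 _ _ _].
  exfalso; move: E1 E3 E4; rewrite !size_cat.
  have := (side_gt0 r1 (~~ e1)); lia.
- case: H2 H3 => -> -> /move_inj[E2 ? ? ?] ->.
  case=> /move_inj[? ? E3 ?] /move_inj[E4 ? ? ?] -> ->; subst.
  move: E2 {E3}; rewrite -!catA => /cat_injl/cat_injl ?; subst.
  exists (move (x3 ++ side r3 e3 ++ y3) s3 (y2 ++ side s2 f2 ++ z2) f3),
    (move (x3 ++ side r3 e3 ++ y3 ++ side s3 (~~ f3) ++ y2) s2 z2 f2),
    (move x3 r3 (y3 ++ side s3 (~~ f3) ++ y2 ++ side s2 f2 ++ z2) e3).
  split.
  + by apply: (@sides_rl _ _ _ y2); rewrite -?catA.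
  + by apply: (@sides_rl _ _ _ (y3 ++ side s3 (~~ f3) ++ y2)); rewrite -?catA.
  + by apply: (@sides_lr _ _ _ y3); rewrite -?catA.
- case: H2 H3 => -> -> /move_inj[E2 ? ? ?] ->.
  case=> -> -> /move_inj[E3 ? ? ?] /move_inj[? ? E4 ?]; subst.
  move: E2 {E4}; rewrite -!catA => /cat_injl/cat_injl ?; subst.
  exists (move x3 r3 (y3 ++ side s3 f3 ++ y1 ++ side s2 f2 ++ z2) e3),
    (move (x3 ++ side r3 (~~ e3) ++ y3 ++ side s3 f3 ++ y1) s2 z2 f2),
    (move (x3 ++ side r3 (~~ e3) ++ y3) s3 (y1 ++ side s2 f2 ++ z2) f3).
  split.
  + by apply: (@sides_rl _ _ _ (y3 ++ side s3 f3 ++ y1)); rewrite -?catA.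
  + by apply: (@sides_rl _ _ _ y1); rewrite -?catA.
  + by apply: (@sides_rl _ _ _ y3); rewrite -?catA.
Qed.

(** * Colouring by the dimension of the right factor *)

Lemma connected_cat x (u v : S 0) : connected u v -> @connected S (x ++ u) (x ++ v).
Proof.
move=> [w]; elim: w u => [|z w IH] u /=; first by move=> ->; exact: connected_refl.
move=> [[[[[y r] y'] e] <- <-] /IH H].
apply: (@connected_trans S _ _ _ _ H); apply: (@connected_adj S).
exists (move (x ++ y) r y' e);
  by rewrite /osource /otarget /= /move /squier_face /= !catA.
Qed.

Lemma connected_move x r e y :
  @connected S (x ++ side r e ++ y) (x ++ side r (~~ e) ++ y).
Proof.
apply: (@connected_adj S); exists (move x r y e);
  by rewrite /osource /otarget /= catA.
Qed.

(** The choice of corner is immaterial, since all corners of a cube are connected. *)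
Definition fits u n : Prop :=
  exists c : S n, @connected S u (corner c (fun=> false)).

(* The dimension of the component of [u], whenever it is finite. *)
Definition rank u : nat :=
  xget 0 [set n | fits u n /\ forall m, fits u m -> m <= n].

Lemma fits_connected u v n : @connected S u v -> fits u n -> fits v n.
Proof.
move=> /connected_sym H [c Hc]; exists c; exact: connected_trans H Hc.
Qed.

Lemma rank_connected u v : @connected S u v -> rank u = rank v.
Proof.
move=> H; suff E : fits u = fits v by rewrite /rank E.
apply: funext => n; apply: propext; split; first exact: fits_connected.
exact/fits_connected/connected_sym.
Qed.

Lemma fits0 u : fits u 0.
Proof. by exists u; exact: connected_refl. Qed.

(** The bound ensures that a maximum exists, so [xget] does not fall back on its default value. *)
Lemma rankP u d : (forall m, fits u m -> m <= d) ->
  fits u (rank u) /\ forall m, fits u m -> m <= rank u.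
Proof.
move=> bnd; rewrite /rank; case: xgetP => [n -> //|none].
have ex : exists n, `[< fits u n >] by exists 0; apply/asboolP; exact: fits0.
have [|n /asboolP fn max] := @ex_maxnP _ d ex; first by move=> m /asboolP/bnd.
by case: (none n); split=> // m fm; apply: max; exact/asboolP.
Qed.

Lemma corner_prepend n x (c : S n) (f : 'I_n -> bool) :
  corner (prepend x c : S n) f = x ++ corner c f.
Proof.
elim: n c f => [//|n IH] c f.
rewrite [LHS]/= [corner c f]/= -IH /squier_face squier_face_prepend //.
Qed.

(** The move [r] is disjoint from the moves of a cube inside the right factor, and spans with them a
    cube of one more dimension. *)
Lemma fits_cons x r e y n : fits y n -> fits (x ++ side r e ++ y) n.+1.
Proof.
move=> [c Hc]; exists (x, r, c).
have -> : corner ((x, r, c) : S n.+1) (fun=> false) =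
    (x ++ side r false) ++ corner c (fun=> false).
  by rewrite -corner_prepend; case: n c {Hc}.
apply: (@connected_trans S _ (x ++ side r false ++ y)); last first.
  by rewrite catA; exact: connected_cat.
by case: e; [exact: connected_move|exact: (@connected_refl S)].
Qed.

Lemma rank_cons x r e y d : (forall m, fits (x ++ side r e ++ y) m -> m <= d) ->
  rank y < rank (x ++ side r e ++ y).
Proof.
move=> bnd; have [_ max] := rankP bnd; apply/max/fits_cons.
apply: (proj1 (@rankP y d _)) => m fm.
by apply: leq_trans (leqnSn m) _; apply/bnd/fits_cons.
Qed.

Definition edge_rank (a : S 1) : nat := rank a.2.

Lemma edge_rank_parallel (a b c d : oedge S) :
  square_sides a b c d -> edge_rank a.1 = edge_rank d.1.
Proof.
move=> /square_sidesE[] [x [r [e [y [s [f [z [Ea Eb Ec Ed]]]]]]]].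
  by rewrite Ea Ed; exact/rank_connected/connected_move.
by rewrite Ec Eb.
Qed.

Lemma edge_rank_transverse (a b c d : oedge S) D :
  (forall m, fits a.1.2 m -> m <= D) -> (forall m, fits b.1.2 m -> m <= D) ->
  square_sides a b c d -> edge_rank a.1 != edge_rank b.1.
Proof.
move=> bnda bndb /square_sidesE[] [x [r [e [y [s [f [z H]]]]]]];
  case: H => Ea Eb Ec Ed; rewrite neq_ltn; apply/orP.
- by right; rewrite Ea Eb; apply: (@rank_cons _ _ _ _ D); rewrite Ea in bnda.
- by left; rewrite Ec Ed; apply: (@rank_cons _ _ _ _ D); rewrite Ed in bndb.
Qed.

End SquierGeometry.

(** * The embedding of the universal cover *)

Unset Implicit Arguments.

Theorem theorem1p4 (Sigma : Type) (P : presentation Sigma) (w : seq Sigma)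
    (w_neq1 : w <> [::]) (d : nat)
    (dimS : has_dim (squier_component P w) d)
    (X : cube_complex) (p : forall n, X n -> squier_component P w n)
    (univX : is_universal_cover p) :
  exists T : 'I_d -> graph,
    (forall i, is_tree (T i)) /\
    exists f : X 0 -> forall i, T i,
      forall x y : X 0,
        comb_dist x y = (\sum_(i < d) graph_dist (f x i) (f y i))%N.
Proof.
have [cov simpX] := univX.
(* The target is enlarged to the whole Squier complex, because the right factors that define the
   colours may lie in other components. *)
pose q n (c : X n) : squier_complex P n := sval (p n c).
have qcov : is_covering q by exact: covering_component cov.
pose colour (e : X 1) := edge_rank (q 1 e).
(* The inequality is strict because the move of [e] itself adds a dimension; hence the colours lie
   in the range from 0 to [d - 1], one per tree. *)
have bnd (e : X 1) m : fits P (q 1 e).2 m -> m < d.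
  move=> fm; case E: (q 1 e) fm => [[x r] y] /= fm.
  have [c Hc] := fits_cons x r false fm; apply: dimS.2; split.
  exists c; apply: (@in_component_connected _ _ _ _ (fun=> false)).
  apply: connected_trans Hc.
  have : @connected (squier_complex P) w (q 0 (face false ord0 e)).
    exact: (svalP (p 0 (face false ord0 e)) (fun=> false)).
  by rewrite (covering_face qcov) E /= /squier_face /= -catA.
have colour_bnd e : colour e < d.
  have := @rankP _ P (q 1 e).2 d (fun m fm => ltnW (bnd e m fm)).
  by move=> [/bnd].
have sidesE := @push_sides _ _ q qcov.
have colour_par (a b c d' : oedge X) :
    square_sides a b c d' -> colour a.1 = colour d'.1.
  by move=> /sidesE/edge_rank_parallel.
have colour_trans (a b c d' : oedge X) :
    square_sides a b c d' -> colour a.1 != colour b.1.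
  by move=> /sidesE; apply: (@edge_rank_transverse _ _ _ _ _ _ d) => m /bnd/ltnW.
have det := covering_sides_det qcov (@squier_sides_det _ P).
have cube := covering_sides_cube qcov (@squier_sides_cube _ P).
have irr (a c d' : oedge X) : ~ square_sides a (orev a) c d'.
  by move=> /sidesE/squier_sides_irr.
exists (fun i => contracted_graph colour i); split.
  by move=> i; exact: contracted_graph_tree.
exists (fun x i => contract colour i x) => x y.
exact: comb_dist_contract.
Qed.
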